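(* For every integer $n\ge 0$ let $$a_n=\binom{2n}{n}\binom{3n}{n}\binom{6n}{3n},\qquad A_n=1728^{n}\sum_{k=0}^{n}\binom{-1/12}{k}\binom{-7/12}{k}\binom{-5/12}{n-k}\binom{-11/12}{n-k}.$$ Then, as an identity of power series in $x$ (equivalently, for all sufficiently small $|x|$, with the branch of the square root equal to $1$ at $x=0$), $$\sum_{n=0}^{\infty}A_nx^n=\frac{1}{\sqrt{1-1728x}}\sum_{n=0}^{\infty}a_n\left(-\frac{x}{1-1728x}\right)^n .$$
   Context: For a real number $\alpha$ and an integer $k\ge 0$, $\binom{\alpha}{k}=\frac{\alpha(\alpha-1)\cdots(\alpha-k+1)}{k!}$ is the generalized binomial coefficient. *)

(* Defs.v *)
From HB Require Import structures.
From mathcomp Require Import all_boot all_order all_algebra.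
From mathcomp Require Import boolp.

Set Implicit Arguments.
Unset Strict Implicit.
Unset Printing Implicit Defensive.

Import Order.TTheory GRing.Theory Num.Theory.
Local Open Scope ring_scope.

(* [FPS u] is the formal power series \sum_(n >= 0) u n * x^n over F. *)
Record fps (F : fieldType) := FPS { fpscoef : nat -> F }.
Notation "f .[[ n ]]" := (fpscoef f n)
  (at level 2, n at level 200, left associativity, format "f .[[ n ]]").

Section FpsRing.
Variable F : fieldType.
Implicit Types f g h : fps F.

Lemma fpsP f g : (forall n, f.[[n]] = g.[[n]]) <-> f = g.
Proof.
split=> [|-> //]; case: f g => [u] [v] /= uv; congr FPS; exact/funext.
Qed.

Let fps_fpscoefK : cancel (@fpscoef F) (@FPS F). Proof. by case. Qed.
HB.instance Definition _ := Equality.copy (fps F) (can_type fps_fpscoefK).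
HB.instance Definition _ := Choice.copy (fps F) (can_type fps_fpscoefK).

Definition fps_zero : fps F := FPS (fun=> 0).
Definition fps_opp f := FPS (fun n => - f.[[n]]).
Definition fps_add f g := FPS (fun n => f.[[n]] + g.[[n]]).
Definition fps_one : fps F := FPS (fun n => (n == 0%N)%:R).
Definition fps_mul f g := FPS (fun n => \sum_(i < n.+1) f.[[i]] * g.[[n - i]]).

Fact fps_addA : associative fps_add.
Proof. by move=> f g h; apply/fpsP=> n /=; rewrite addrA. Qed.
Fact fps_addC : commutative fps_add.
Proof. by move=> f g; apply/fpsP=> n /=; rewrite addrC. Qed.
Fact fps_add0 : left_id fps_zero fps_add.
Proof. by move=> f; apply/fpsP=> n /=; rewrite add0r. Qed.
Fact fps_addN : left_inverse fps_zero fps_opp fps_add.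
Proof. by move=> f; apply/fpsP=> n /=; rewrite addNr. Qed.

HB.instance Definition _ :=
  GRing.isZmodule.Build (fps F) fps_addA fps_addC fps_add0 fps_addN.

Let trunc N f : {poly F} := \poly_(i < N) f.[[i]].

Let fps_mul_trunc N f g n : (n < N)%N ->
  (fps_mul f g).[[n]] = (trunc N f * trunc N g)`_n.
Proof.
move=> ltnN; rewrite coefM; apply: eq_bigr => i _.
rewrite !coef_poly (leq_ltn_trans (leq_subr _ _) ltnN).
by rewrite (leq_ltn_trans _ ltnN) // -ltnS.
Qed.

Fact fps_mulC : commutative fps_mul.
Proof.
by move=> f g; apply/fpsP=> n; rewrite !(@fps_mul_trunc n.+1) // mulrC.
Qed.

Let mul_truncl N f g h n : (n < N)%N ->
  (trunc N (fps_mul f g) * trunc N h)`_n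
    = (trunc N f * trunc N g * trunc N h)`_n.
Proof.
move=> ltnN; rewrite !coefM; apply: eq_bigr => i _; congr (_ * _).
have ltiN : (i < N)%N by rewrite (leq_ltn_trans _ ltnN) // -ltnS.
by rewrite coef_poly ltiN -fps_mul_trunc.
Qed.

Fact fps_mulA : associative fps_mul.
Proof.
move=> f g h; apply/fpsP=> n; rewrite fps_mulC !(@fps_mul_trunc n.+1) //.
by rewrite !mul_truncl // mulrC mulrA.
Qed.

Fact fps_mul1 : left_id fps_one fps_mul.
Proof.
move=> f; apply/fpsP=> n /=.
rewrite big_ord_recl /= mul1r subn0 big1 ?addr0 // => i _.
by rewrite mul0r.
Qed.

Fact fps_mulDl : left_distributive fps_mul fps_add.
Proof.
move=> f g h; apply/fpsP=> n /=; rewrite -big_split.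
by apply: eq_bigr => i _; rewrite mulrDl.
Qed.

Fact fps_one_neq0 : fps_one != 0 :> fps F.
Proof. by apply/eqP=> /fpsP/(_ 0%N)/eqP; rewrite /= oner_eq0. Qed.

HB.instance Definition _ := GRing.Zmodule_isComNzRing.Build (fps F)
  fps_mulA fps_mulC fps_mul1 fps_mulDl fps_one_neq0.

Lemma fpscoef0 n : (0 : fps F).[[n]] = 0. Proof. by []. Qed.
Lemma fpscoef1 n : (1 : fps F).[[n]] = (n == 0%N)%:R. Proof. by []. Qed.
Lemma fpscoefN f n : (- f).[[n]] = - f.[[n]]. Proof. by []. Qed.
Lemma fpscoefD f g n : (f + g).[[n]] = f.[[n]] + g.[[n]]. Proof. by []. Qed.
Lemma fpscoefB f g n : (f - g).[[n]] = f.[[n]] - g.[[n]]. Proof. by []. Qed.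
Lemma fpscoefM f g n :
  (f * g).[[n]] = \sum_(i < n.+1) f.[[i]] * g.[[n - i]].
Proof. by []. Qed.
Lemma fpscoef_sum I (r : seq I) (P : pred I) (G : I -> fps F) n :
  (\sum_(i <- r | P i) G i).[[n]] = \sum_(i <- r | P i) (G i).[[n]].
Proof. by elim/big_rec2: _ => // i y f _ <-. Qed.
Lemma fpscoef0M f g : (f * g).[[0]] = f.[[0]] * g.[[0]].
Proof. by rewrite fpscoefM big_ord1. Qed.

Lemma fpscoef_exp_lt f k n : f.[[0]] = 0 -> (n < k)%N -> (f ^+ k).[[n]] = 0.
Proof.
move=> f0; elim: k n => [//|k IHk] n; rewrite ltnS exprS fpscoefM => lenk.
apply: big1 => -[[|i] /= lein] _; first by rewrite f0 mul0r.
rewrite IHk ?mulr0 //; apply: leq_trans lenk.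
by rewrite ltn_subLR // addSn ltnS leq_addl.
Qed.

Definition fps_const c : fps F := FPS (fun n => if n is 0 then c else 0).

Lemma fpscoefCM c f n : (fps_const c * f).[[n]] = c * f.[[n]].
Proof.
rewrite fpscoefM big_ord_recl subn0 big1 ?addr0 // => i _.
by rewrite mul0r.
Qed.

(* The invertible series are those with f(0) != 0, and then
   f^-1 = c^-1 * \sum_k (1 - f/c)^k with c = f(0); the power (1 - f/c)^k
   has no coefficient below x^k, so that each coefficient is a finite sum. *)
Definition fps_unit : {pred fps F} := fun f => f.[[0]] != 0.
Definition fps_inv f : fps F :=
  if f.[[0]] != 0 then
    FPS (fun n => f.[[0]]^-1 *
           \sum_(k < n.+1) ((1 - fps_const f.[[0]]^-1 * f) ^+ k).[[n]])
  else f.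

Fact fps_mulV : {in fps_unit, left_inverse 1 fps_inv *%R}.
Proof.
move=> f f0; rewrite mulrC; apply/fpsP=> n.
have {}f0 : f.[[0]] != 0 by exact: f0.
set c := fps_const f.[[0]]^-1; set h := 1 - c * f.
have h0 : h.[[0]] = 0 by rewrite fpscoefB fpscoefCM mulVf // subrr.
have -> : (f * fps_inv f).[[n]] = (c * f * \sum_(k < n.+1) h ^+ k).[[n]].
  rewrite !fpscoefM; apply: eq_bigr => i _.
  rewrite fpscoefCM /fps_inv f0 /= mulrCA mulrA; congr (_ * _).
  rewrite fpscoef_sum -!(big_mkord xpredT (fun k => (h ^+ k).[[n - i]])).
  rewrite [RHS](@big_cat_nat _ _ _ (n - i).+1) ?ltnS ?leq_subr //=.
  rewrite -[LHS]addr0; congr (_ + _); rewrite big_nat big1 // => k /andP[ltk _].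
  exact: fpscoef_exp_lt.
have -> : c * f = 1 - h by rewrite opprB addrC subrK.
have := subrX1 h n.+1; rewrite -[h ^+ _ - 1]opprB -[h - 1]opprB mulNr.
move/oppr_inj => <-; rewrite fpscoefB fpscoef_exp_lt // subr0.
by [].
Qed.

Fact fps_unitPl f g : g * f = 1 -> fps_unit f.
Proof.
move=> /fpsP/(_ 0%N); rewrite fpscoef0M fpscoef1 eqxx => gf1.
by apply/eqP=> f0; move: gf1 => /eqP; rewrite f0 mulr0 eq_sym oner_eq0.
Qed.

Fact fps_invr_out : {in [predC fps_unit], fps_inv =1 id}.
Proof. by move=> f; rewrite inE /= /fps_inv => /negbTE f0; rewrite ifF. Qed.

HB.instance Definition _ := GRing.ComNzRing_hasMulInverse.Build (fps F)
  fps_mulV fps_unitPl fps_invr_out.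

Lemma fps_unitE f : (f \is a GRing.unit) = (f.[[0]] != 0).
Proof. by []. Qed.

Definition fpsX : fps F := FPS (fun n => (n == 1%N)%:R).

(* The substitution f(g(x)). It is only meaningful when g(0) = 0: the powers
   g ^+ k with k > n then do not contribute to the coefficient of x^n. *)
Definition fps_comp f g : fps F :=
  FPS (fun n => \sum_(k < n.+1) f.[[k]] * (g ^+ k).[[n]]).

(* The square root of f with constant term 1, for f(0) = 1 and 2 != 0 in F;
   its coefficients s_n are obtained by solving s ^ 2 = f degree by degree
   (see [fps_sqrtP]). *)
Fixpoint fps_sqrt_seq f n : seq F :=
  if n is m.+1 then
    let s := fps_sqrt_seq f m in
    rcons s (if m is 0 then 1
             else (f.[[m]] - \sum_(1 <= i < m) s`_i * s`_(m - i)) / 2)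
  else [::].

Definition fps_sqrt f : fps F := FPS (fun n => (fps_sqrt_seq f n.+1)`_n).

Lemma fps_sqrt0 f : (fps_sqrt f).[[0]] = 1.
Proof. by []. Qed.

Let size_fps_sqrt_seq f n : size (fps_sqrt_seq f n) = n.
Proof. by elim: n => //= n IHn; rewrite size_rcons IHn. Qed.

Let fps_sqrt_seqE f n i : (i < n)%N ->
  (fps_sqrt_seq f n)`_i = (fps_sqrt f).[[i]].
Proof.
elim: n => // n IHn; rewrite ltnS leq_eqVlt => /orP[/eqP-> //|ltin].
by rewrite -IHn //= nth_rcons size_fps_sqrt_seq ltin.
Qed.

Lemma fps_sqrtP f (s : fps F) : (2 : F) != 0 -> f.[[0]] = 1 ->
  s ^+ 2 = f /\ s.[[0]] = 1 <-> s = fps_sqrt f.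
Proof.
move=> nz2 f0.
have sqf : fps_sqrt f ^+ 2 = f.
  apply/fpsP=> -[|m]; first by rewrite expr2 fpscoef0M !fps_sqrt0 mulr1 f0.
  rewrite expr2 fpscoefM big_ord_recl big_ord_recr lift0 subnn subn0.
  rewrite !fps_sqrt0 mul1r mulr1.
  under eq_bigr do rewrite lift0 subSS.
  have -> : (fps_sqrt f).[[m.+1]] =
      (f.[[m.+1]] - \sum_(i < m) (fps_sqrt f).[[i.+1]]
                               * (fps_sqrt f).[[m - i]]) / 2.
    rewrite {1}/fps_sqrt [LHS]/=.
    set s1 := (X in rcons X).
    have sz : size s1 = m.+1 by rewrite size_rcons size_fps_sqrt_seq.
    rewrite nth_rcons sz ltnn eqxx big_add1 big_mkord.
    congr ((_ - _) / 2); apply: eq_bigr => i _.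
    rewrite -/(fps_sqrt_seq f m.+1) !fps_sqrt_seqE ?ltnS // subSS //.
    exact: leq_subr.
  have half2 (x : F) : x / 2 + x / 2 = x.
    by rewrite -mulrDl -mulr2n -[x *+ 2]mulr_natr mulfK.
  by rewrite addrCA half2 addrC subrK.
split=> [[sf s0]|->//].
have unit_sD : s + fps_sqrt f \is a GRing.unit.
  by rewrite fps_unitE fpscoefD fps_sqrt0 s0.
apply/eqP; rewrite -subr_eq0 -(mulIr_eq0 _ (mulIr unit_sD)).
by rewrite -subr_sqr sf sqf subrr.
Qed.

End FpsRing.

Arguments fpsX {F}.

(* The generalized binomial coefficient
   alpha (alpha - 1) ... (alpha - k + 1) / k!. *)
Definition gbinom (F : fieldType) (alpha : F) (k : nat) : F :=
  (\prod_(i < k) (alpha - i%:R)) / k`!%:R.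

Definition a_coef (n : nat) : nat :=
  'C(2 * n, n) * 'C(3 * n, n) * 'C(6 * n, 3 * n).

Definition A_coef (F : fieldType) (n : nat) : F :=
  1728 ^+ n * \sum_(k < n.+1)
    gbinom (- (1 / 12)) k * gbinom (- (7 / 12)) k *
    gbinom (- (5 / 12)) (n - k) * gbinom (- (11 / 12)) (n - k).

(* Main.v *)
(* Put y = 1728 x. The generating series of A_n is the product f g of the
   hypergeometric series f = 2F1(1/12, 7/12; 1; y) and
   g = 2F1(5/12, 11/12; 1; y). With the derivation E = 12 (1 - y) x d/dx these
   satisfy second-order equations, and their Wronskian is proportional to f g,
   so that sqrt(1 - y) f g satisfies the third-order equation
     E^3 v + y (18 E^2 v + 92 E v + 120 v) = 0
   (a case of Clausen's identity). The recurrence for a_n and the chain rule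
   give the same equation for sum_n a_n (- x / (1 - y))^n. Its indicial
   equation at 0 is r^3 = 0, so a power series solution is determined by its
   constant term. *)

Require Import Defs.
From mathcomp Require Import all_boot all_order all_algebra.
From mathcomp Require Import ring zify.

Set Implicit Arguments.
Unset Strict Implicit.

Import GRing.Theory Num.Theory.
Local Open Scope ring_scope.

(** * Derivations of a commutative ring *)

Section DerivationAlgebra.
Variables (R : comNzRingType) (D : R -> R).
Hypothesis DD : {morph D : a b / a + b}.
Hypothesis DM : forall a b, D (a * b) = D a * b + a * D b.

Lemma deriv0 : D 0 = 0.
Proof. by apply: (addrI (D 0)); rewrite -DD !addr0. Qed.

Lemma derivN a : D (- a) = - D a.
Proof. by apply: (addrI (D a)); rewrite -DD !subrr deriv0. Qed.

Lemma deriv_nat n : D n%:R = 0.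
Proof.
elim: n => [|n IHn]; first exact: deriv0.
rewrite -natr1 DD IHn add0r; apply: (addrI (D 1)).
by rewrite -[in RHS](mulr1 1) DM mulr1 mul1r addr0.
Qed.

Let DE := (DD, derivN, DM, deriv_nat 1, deriv_nat).

Lemma deriv_exp w c k : D w = c * w -> D (w ^+ k) = k%:R * (c * w ^+ k).
Proof.
move=> Dw; elim: k => [|k IHk]; first by rewrite mul0r (deriv_nat 1).
by rewrite exprS DM Dw IHk -natr1; ring.
Qed.

Variables y f g : R.
Let p := 1 - y.
Hypothesis Dy : D y = 12 * p * y.
Hypothesis Df : D (D f) = 7 * y * p * f - 4 * y * D f.
Hypothesis Dg : D (D g) = 55 * y * p * g + 4 * y * D g.

(* Once the bracket is known to vanish at x = 0 it vanishes identically, which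
   is Euler's transformation g = (1 - y)^(-1/3) f. *)
Lemma deriv_wronskian : D (f * D g - (D f * g + 4 * y * (f * g))) = 0.
Proof. by rewrite !DE Df Dg Dy /p; ring. Qed.

Hypothesis W : f * D g = D f * g + 4 * y * (f * g).

(* The span of h = f g, m = (D f) g and q = (D f) (D g) is stable under D. *)
Lemma deriv_prod_ode s (v := s * (f * g)) : D s = - (6 * y * s) ->
  D (D (D v)) + y * (18 * D (D v) + 92 * D v + 120 * v) = 0.
Proof.
move=> Ds; rewrite {}/v; set h := f * g; set m := D f * g; set q := D f * D g.
(* [W] eliminates the fourth product [f * D g], so three generators suffice and the equation has
   order three. *)
have Dh : D h = 2 * m + 4 * y * h by rewrite DM W -/h -/m; ring.
have Dm : D m = - (4 * y * m) + 7 * y * p * h + q.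
  by rewrite DM Df /q /h /m; ring.
have Dq : D q = y * p * (62 * m + 28 * y * h).
  rewrite DM Df Dg.
  transitivity (7 * y * p * (f * D g) + 55 * y * p * m); first by rewrite /m; ring.
  by rewrite W -/h -/m; ring.
move: h m q Dh Dm Dq => h m q Dh Dm Dq.
have D1 : D (s * h) = s * (2 * m - 2 * y * h) by rewrite DM Ds Dh; ring.
have D2 : D (D (s * h)) = s * (2 * q - 24 * y * m + (4 * y * y - 10 * y * p) * h).
  by rewrite D1 !DE Ds Dy Dm Dh /p; ring.
by rewrite D2 D1 /p !DE Ds Dy Dq Dm Dh /p; ring.
Qed.

End DerivationAlgebra.

(** * The Euler derivation of power series and substitution *)

Section EulerDerivation.
Variable F : fieldType.
Implicit Types (f g u v w : fps F) (n k : nat).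

Lemma fpscoefMn f m n : (f *+ m).[[n]] = f.[[n]] *+ m.
Proof. by elim: m => // m IHm; rewrite !mulrS fpscoefD IHm. Qed.

Lemma fpscoef_natM m f n : (m%:R * f).[[n]] = m%:R * f.[[n]].
Proof. by rewrite !mulr_natl fpscoefMn. Qed.

Lemma fpscoefXM f n : (fpsX * f).[[n]] = if n is m.+1 then f.[[m]] else 0.
Proof.
case: n => [|n]; first by rewrite fpscoef0M mul0r.
rewrite fpscoefM big_ord_recl /= mul0r add0r big_ord_recl /= mul1r subn1.
by rewrite big1 ?addr0 // => i _; rewrite mul0r.
Qed.

Definition theta f : fps F := FPS (fun n => n%:R * f.[[n]]).

Lemma fpscoef_theta f n : (theta f).[[n]] = n%:R * f.[[n]].
Proof. by []. Qed.

Lemma thetaD f g : theta (f + g) = theta f + theta g.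
Proof. by apply/fpsP=> n /=; rewrite mulrDr. Qed.

Lemma thetaM f g : theta (f * g) = theta f * g + f * theta g.
Proof.
apply/fpsP=> n; rewrite fpscoefD !fpscoefM /= mulr_sumr -big_split /=.
apply: eq_bigr => i _; have -> : n%:R = (n - i)%:R + i%:R :> F.
  by rewrite -natrD subnK ?leq_ord.
by ring.
Qed.

Lemma thetaX : theta fpsX = fpsX.
Proof. by apply/fpsP=> -[|[|n] ] /=; rewrite ?mul0r ?mulr1 ?mulr0. Qed.

Variable p : fps F.

(* With p = 1 - 1728 x, the factor p makes [Ederiv_comp] hold for
   w = - x / p, and 12 clears the denominators of the parameters. *)
Definition Ederiv f : fps F := p * (12 * theta f).

Lemma EderivD f g : Ederiv (f + g) = Ederiv f + Ederiv g.
Proof. by rewrite /Ederiv thetaD; ring. Qed.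

Lemma EderivM f g : Ederiv (f * g) = Ederiv f * g + f * Ederiv g.
Proof. by rewrite /Ederiv thetaM; ring. Qed.

(** The sum defining a coefficient of [fps_comp] has a length that depends on the degree. Working up
    to degree n replaces the composite by one fixed polynomial in w, to which sum and product rules
    apply. *)
Definition fps_eq_upto n f g := forall i, (i <= n)%N -> f.[[i]] = g.[[i]].

Lemma fps_eq_uptoM n u f g :
  fps_eq_upto n f g -> fps_eq_upto n (u * f) (u * g).
Proof.
move=> fg i lein; rewrite !fpscoefM; apply: eq_bigr => j _.
by rewrite fg // (leq_trans (leq_subr _ _)).
Qed.

Lemma fps_eq_upto_Ederiv n f g :
  fps_eq_upto n f g -> fps_eq_upto n (Ederiv f) (Ederiv g).
Proof.
by move=> fg; do 2!apply: fps_eq_uptoM; move=> i lein /=; rewrite fg.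
Qed.

Lemma fps_comp_trunc n f w : w.[[0]] = 0 ->
  fps_eq_upto n (fps_comp f w) (\sum_(k < n.+1) fps_const f.[[k]] * w ^+ k).
Proof.
move=> w0 i lein; rewrite fpscoef_sum [LHS]/=.
under [RHS]eq_bigr do rewrite fpscoefCM.
rewrite -!(big_mkord xpredT (fun k => f.[[k]] * (w ^+ k).[[i]])).
rewrite [RHS](@big_cat_nat _ _ _ i.+1) //= -[LHS]addr0; congr (_ + _).
rewrite big_nat big1 // => k /andP[ltik _].
by rewrite fpscoef_exp_lt // mulr0.
Qed.

(** Chain rule: since [Ederiv w = 12 * w], [Ederiv] multiplies w^k by 12 k, just as [12 * theta]
    does with x^k. *)
Lemma Ederiv_comp f w : w.[[0]] = 0 -> Ederiv w = 12 * w ->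
  Ederiv (fps_comp f w) = fps_comp (12 * theta f) w.
Proof.
move=> w0 Ew; apply/fpsP=> n.
rewrite (fps_eq_upto_Ederiv (@fps_comp_trunc n f _ w0)) //.
rewrite (@fps_comp_trunc n) //; congr (_ .[[ n ]]).
have Ec c : Ederiv (fps_const c) = 0.
  have -> : Ederiv (fps_const c) = p * (12 * 0); last by rewrite !mulr0.
  by congr (_ * (_ * _)); apply/fpsP=> -[|i] /=; rewrite ?mul0r ?mulr0.
have E0 : Ederiv 0 = 0 by exact: (deriv0 EderivD).
rewrite (big_morph _ EderivD E0); apply: eq_bigr => k _.
rewrite EderivM Ec mul0r add0r (deriv_exp EderivD EderivM k Ew) !mulrA.
congr (_ * _); apply/fpsP=> i; rewrite -mulrA mulrC -natrM !fpscoef_natM fpscoef_theta.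
by case: i => [|i] /=; rewrite ?mulr0 // natrM; ring.
Qed.

Lemma fps_compXM f w : w.[[0]] = 0 ->
  fps_comp (fpsX * f) w = w * fps_comp f w.
Proof.
move=> w0; apply/fpsP=> n.
(* The left side is truncated one degree later: once its zero constant term is dropped, both sums
   have n + 1 terms. *)
rewrite (@fps_comp_trunc n.+1) // (fps_eq_uptoM w (@fps_comp_trunc n f _ w0)) //.
congr (_ .[[ n ]]); rewrite big_ord_recl fpscoefXM mulr_sumr.
have -> : fps_const 0 = 0 :> fps F by apply/fpsP; case.
rewrite mul0r add0r; apply: eq_bigr => k _.
by rewrite lift0 fpscoefXM exprS mulrCA.
Qed.

Lemma fps_compD f g w : fps_comp (f + g) w = fps_comp f w + fps_comp g w.
Proof.
apply/fpsP=> n /=; rewrite -big_split /=.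
by apply: eq_bigr => k _; rewrite mulrDl.
Qed.

Lemma fps_comp_natM m f w : fps_comp (m%:R * f) w = m%:R * fps_comp f w.
Proof.
apply/fpsP=> n; rewrite fpscoef_natM [RHS]/= mulr_sumr.
by apply: eq_bigr => k _; rewrite fpscoef_natM mulrA.
Qed.

End EulerDerivation.

Arguments Ederiv {F} p f.

(** * The operator E for p = 1 - 1728 x and uniqueness of solutions *)

Section Identity.
Variable F : numFieldType.
Implicit Types (f g h u v w d : fps F) (n k : nat).

Let y : fps F := 1728 * fpsX.
Let p : fps F := 1 - y.
Let E := Ederiv p.

Let ED : {morph E : f g / f + g} := @EderivD F p.
Let EM : forall f g, E (f * g) = E f * g + f * E g := @EderivM F p.

Let y0 : y.[[0]] = 0.
Proof. by rewrite fpscoef_natM mulr0. Qed.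

Let p0 : p.[[0]] = 1.
Proof. by rewrite fpscoefB y0 subr0. Qed.

Let theta_y : theta y = y.
Proof. by rewrite /y thetaM thetaX (deriv_nat (@thetaD F) (@thetaM F)) mul0r add0r. Qed.

Let theta_p : theta p = - y.
Proof. by rewrite /p thetaD (derivN (@thetaD F)) theta_y (deriv_nat (@thetaD F) (@thetaM F) 1) add0r. Qed.

Let Ey : E y = 12 * p * y.
Proof. by rewrite /E /Ederiv theta_y; ring. Qed.

Let Ep : E p = - (12 * y * p).
Proof. by rewrite /E /Ederiv theta_p; ring. Qed.

Let E_coef0 d : (E d).[[0]] = 0.
Proof. by rewrite fpscoef0M fpscoef_natM fpscoef_theta mul0r !mulr0. Qed.

Let low_E n d : fps_eq_upto n d 0 -> fps_eq_upto n (E d) 0.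
Proof.
by move=> d0 i /(fps_eq_upto_Ederiv p d0) ->; rewrite (deriv0 (EderivD p)).
Qed.

Let yM_lead n u : fps_eq_upto n u 0 -> (y * u).[[n.+1]] = 0.
Proof. by move=> u0; rewrite -mulrA fpscoef_natM fpscoefXM u0 // mulr0. Qed.

(** The summand -y of p only feeds higher degrees, so E acts on the lowest coefficient as
    [12 * theta]. *)
Let E_lead n d : fps_eq_upto n d 0 ->
  (E d).[[n.+1]] = (12 * n.+1)%:R * d.[[n.+1]].
Proof.
move=> d0; rewrite /E /Ederiv /p mulrBl mul1r fpscoefB yM_lead; last first.
  by move=> i lein; rewrite fpscoef_natM fpscoef_theta d0 // !mulr0.
by rewrite subr0 fpscoef_natM fpscoef_theta mulrA natrM.
Qed.

(** At the first degree n + 1 not yet known to vanish, the multiple of y contributes nothing and E^3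
    contributes the factor (12 (n + 1))^3, nonzero in characteristic 0. *)
Lemma ode_uniq d : d.[[0]] = 0 ->
    E (E (E d)) + y * (18 * E (E d) + 92 * E d + 120 * d) = 0 ->
  d = 0.
Proof.
move=> d0 Ed; suff low n : fps_eq_upto n d 0 by apply/fpsP=> n; exact: low.
elim: n => [|n IHn] i; first by rewrite leqn0 => /eqP->.
rewrite leq_eqVlt ltnS => /orP[/eqP->|]; last exact: IHn.
have [E1 E2] := (low_E IHn, low_E (low_E IHn)).
move/fpsP/(_ n.+1): Ed; rewrite fpscoefD yM_lead; last first.
  move=> j lejn; rewrite !fpscoefD !fpscoef_natM E2 // E1 // IHn //.
  by rewrite !mulr0 !addr0.
rewrite addr0 !E_lead // !mulrA => /eqP; rewrite mulf_eq0 => /orP[|/eqP//].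
by rewrite !mulf_eq0 !orbb pnatr_eq0.
Qed.

Lemma E_eq0 d : d.[[0]] = 0 -> E d = 0 -> d = 0.
Proof.
move=> d0 Ed; apply/fpsP=> -[|n]; first by rewrite d0.
have pU : p \is a GRing.unit by rewrite fps_unitE p0 oner_eq0.
move/(canRL (mulKr pU)): Ed; rewrite mulr0 => /fpsP/(_ n.+1).
rewrite fpscoef_natM fpscoef_theta mulrA -natrM => /eqP; rewrite mulf_eq0 pnatr_eq0.
by move=> /orP[//|/eqP].
Qed.

(** * The square root and the hypergeometric product *)

Let s := fps_sqrt p.

Let sqr_s : s ^+ 2 = p.
Proof. by have [|//] := (fps_sqrtP s _ p0).2 erefl; rewrite pnatr_eq0. Qed.

Let sU : s \is a GRing.unit.
Proof. by rewrite fps_unitE fps_sqrt0 oner_eq0. Qed.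

Let Es : E s = - (6 * y * s).
Proof.
have sU2 : 2 * s \is a GRing.unit.
  by rewrite fps_unitE fpscoef_natM fps_sqrt0 mulr1 pnatr_eq0.
apply: (mulrI sU2).
have -> : 2 * s * E s = E p by rewrite -sqr_s expr2 EM; ring.
by rewrite Ep -sqr_s; ring.
Qed.

(** This is 2F1(a/12, b/12; 1; 1728 x): binom(-c, n) is (-1)^n (c)_n / n!, and the two signs
    cancel. *)
Definition hyp2F1 (a b : nat) : fps F :=
  FPS (fun n => 1728 ^+ n *
        (gbinom (- (a%:R / 12)) n * gbinom (- (b%:R / 12)) n)).

Lemma gbinomS (alpha : F) n :
  n.+1%:R * gbinom alpha n.+1 = (alpha - n%:R) * gbinom alpha n.
Proof.
rewrite /gbinom big_ord_recr factS natrM /= invfM mulrCA [_ * (_^-1 * _)]mulrA.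
by rewrite divff ?pnatr_eq0 // mul1r mulrAC mulrC.
Qed.

(** The hypergeometric equation theta^2 f = y (theta + a/12) (theta + b/12) f, times 144; on
    coefficients it is the ratio of consecutive terms. *)
Lemma hyp2F1_theta a b :
  144 * theta (theta (hyp2F1 a b)) =
    y * (144 * theta (theta (hyp2F1 a b))
         + (12 * (a + b))%:R * theta (hyp2F1 a b) + (a * b)%:R * hyp2F1 a b).
Proof.
apply/fpsP=> n; rewrite /y -mulrA !fpscoef_natM fpscoefXM.
case: n => [|n]; first by rewrite /= !mul0r !mulr0.
rewrite !fpscoefD !fpscoef_natM !fpscoef_theta /hyp2F1 [fpscoef _]/=.
have [Ba Bb] := (gbinomS (- (a%:R / 12)) n, gbinomS (- (b%:R / 12)) n).
transitivity (144 * 1728 ^+ n.+1 * (n.+1%:R * gbinom (- (a%:R / 12) : F) n.+1) *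
              (n.+1%:R * gbinom (- (b%:R / 12) : F) n.+1)); first by ring.
rewrite Ba Bb exprS !natrM natrD.
by field.
Qed.

Lemma hyp2F1_ode a b (f := hyp2F1 a b) :
  E (E f) = y * ((a + b)%:R - 12) * E f + (a * b)%:R * y * p * f.
Proof.
have:= hyp2F1_theta a b; rewrite -/f /E /Ederiv !thetaM (deriv_nat (@thetaD F) (@thetaM F)) theta_p.
move: (theta f) => f1; move: (theta f1) => f2 ode.
have -> : p * (12 * (- y * (12 * f1) + p * (0 * f1 + 12 * f2))) =
   p * (144 * f2 - y * (144 * f2) - 144 * y * f1) by rewrite /p; ring.
by rewrite {1}ode natrM; ring.
Qed.

Lemma hyp2F1_prod_ode (v := s * (hyp2F1 1 7 * hyp2F1 5 11)) :
  E (E (E v)) + y * (18 * E (E v) + 92 * E v + 120 * v) = 0.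
Proof.
(* The coefficient a + b - 12 is -4 for (1, 7) and 4 for (5, 11), the opposite signs required by
   [deriv_wronskian]. *)
have Ef : E (E (hyp2F1 1 7)) = 7 * y * p * hyp2F1 1 7 - 4 * y * E (hyp2F1 1 7).
  by rewrite hyp2F1_ode; ring.
have Eg : E (E (hyp2F1 5 11)) =
    55 * y * p * hyp2F1 5 11 + 4 * y * E (hyp2F1 5 11).
  by rewrite hyp2F1_ode; ring.
apply: (deriv_prod_ode ED EM Ey Ef Eg) Es.
apply/eqP; rewrite -subr_eq0; apply/eqP; apply: E_eq0.
  rewrite fpscoefB fpscoefD fpscoef0M E_coef0 mulr0 fpscoef0M E_coef0 mul0r.
  by rewrite -mulrA fpscoef_natM fpscoef0M y0 mul0r mulr0 !add0r oppr0.
exact: (deriv_wronskian ED EM Ey Ef Eg).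
Qed.

(** * The recurrence for a_n and the substitution w = -x / p *)

Lemma a_coef_fact n : (a_coef n * (n`! ^ 3 * (3 * n)`!) = (6 * n)`!)%N.
Proof.
have B2 := @bin_fact (2 * n) n; have B3 := @bin_fact (3 * n) n.
have B6 := @bin_fact (6 * n) (3 * n).
rewrite /a_coef -B6; last by lia.
have -> : (6 * n - 3 * n = 3 * n)%N by lia.
rewrite -[X in (_ = _ * (X * _))%N]B3; last by lia.
have -> : (3 * n - n = 2 * n)%N by lia.
rewrite -[X in (_ = _ * (_ * (_ * X) * _))%N]B2; last by lia.
have -> : (2 * n - n = n)%N by lia.
by ring.
Qed.

Lemma a_coefS n : (n.+1 ^ 3 * a_coef n.+1 =
  8 * (6 * n + 1) * (6 * n + 3) * (6 * n + 5) * a_coef n)%N.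
Proof.
have := a_coef_fact n.+1; rewrite !mulnS !addSn !add0n.
rewrite !factS -a_coef_fact => an.
(* The factors 6n+2, 6n+4, 6n+6 of (6n+6)! / (6n)! are twice 3n+1, 3n+2, 3n+3; cancelling the latter
   leaves the 8. *)
have pos : (0 < n`! ^ 3 * (3 * n)`! * ((3 * n).+1 * (3 * n).+2 * (3 * n).+3))%N.
  by rewrite !muln_gt0 !fact_gt0.
apply/eqP; rewrite -(eqn_pmul2r pos); apply/eqP.
transitivity (a_coef n.+1 * ((n.+1 * n`!) ^ 3 *
   ((3 * n).+3 * ((3 * n).+2 * ((3 * n).+1 * (3 * n)`!)))))%N; first by ring.
by rewrite an; ring.
Qed.

Let C : fps F := FPS (fun n => (a_coef n)%:R).

Let T f : fps F := 12 * theta f.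

(** With t = 12 n, the factor 8 (6n+1) (6n+3) (6n+5) is (t+2) (t+6) (t+10) = t^3 + 18 t^2 + 92 t +
    120. *)
Lemma a_coef_ode :
  T (T (T C)) = 1728 * (fpsX * (T (T (T C)) + (18 * T (T C) + 92 * T C + 120 * C))).
Proof.
apply/fpsP=> n; rewrite fpscoef_natM fpscoefXM /T !(fpscoef_natM, fpscoef_theta).
case: n => [|n]; first by rewrite /= !mul0r !mulr0.
rewrite !(fpscoefD, fpscoef_natM, fpscoef_theta) [fpscoef _]/=.
transitivity (1728 * (n.+1 ^ 3 * a_coef n.+1)%N%:R : F); first by rewrite natrM natrX; ring.
by rewrite a_coefS !(natrM, natrD); ring.
Qed.

Let w : fps F := - (fpsX / p).

Let pU : p \is a GRing.unit.
Proof. by rewrite fps_unitE p0 oner_eq0. Qed.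

Let pw : p * w = - fpsX.
Proof. by rewrite /w mulrN mulrC divrK. Qed.

Let w0 : w.[[0]] = 0.
Proof. by rewrite fpscoefN fpscoef0M mul0r oppr0. Qed.

(** The Leibniz rule applied to p w = -x avoids differentiating an inverse. *)
Let Ew : E w = 12 * w.
Proof.
apply: (mulrI pU).
have : E (p * w) = - (12 * p * fpsX).
  by rewrite pw (derivN ED) /E /Ederiv thetaX; ring.
rewrite EM Ep => /(canRL (addKr _)) ->.
transitivity (12 * (y * (p * w) - p * fpsX)); first by ring.
have -> : p * (12 * w) = 12 * (p * w) by ring.
by rewrite pw /p; ring.
Qed.

Lemma a_coef_comp_ode (v := fps_comp C w) :
  E (E (E v)) + y * (18 * E (E v) + 92 * E v + 120 * v) = 0.
Proof.
have EC f : E (fps_comp f w) = fps_comp (T f) w by exact: Ederiv_comp.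
move: a_coef_ode; rewrite /v !EC.
move: (T C) => t1; move: (T t1) => t2; move: (T t2) => t3.
move/(congr1 (fun f => fps_comp f w)).
rewrite /= fps_comp_natM fps_compXM // !(fps_compD, fps_comp_natM).
move: (fps_comp t3 w) => e3; move: (18 * _ + _ + _) => r ode.
(* The composed equation is e3 = 1728 w (e3 + r); multiplied by p it reads p e3 = -y (e3 + r),
   because p w = -x. *)
have -> : e3 + y * r = p * e3 + y * (e3 + r) by rewrite /p; ring.
rewrite {1}ode; transitivity (1728 * (p * w) * (e3 + r) + y * (e3 + r)).
  by ring.
by rewrite pw /y; ring.
Qed.

(** * Comparison of the two solutions *)

Lemma A_coefE : FPS (A_coef F) = hyp2F1 1 7 * hyp2F1 5 11.
Proof.
apply/fpsP=> n; rewrite fpscoefM /= /A_coef mulr_sumr.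
apply: eq_bigr => i _; rewrite -[n in 1728 ^+ n](subnKC (leq_ord i)) exprD.
by ring.
Qed.

Lemma A_coef_identity : FPS (A_coef F) = s^-1 * fps_comp C w.
Proof.
apply: (canRL (mulKr sU)); rewrite A_coefE.
apply/eqP; rewrite -subr_eq0; apply/eqP; apply: ode_uniq.
  rewrite fpscoefB !fpscoef0M fps_sqrt0 /= /gbinom big_ord1 !big_ord0 /=.
  by rewrite /a_coef !muln0 !bin0 !mulr1 !divr1 !mulr1 subrr.
have := congr2 (fun a b => a - b) hyp2F1_prod_ode a_coef_comp_ode.
rewrite subr0 => <-.
rewrite !(ED, derivN ED).
by ring.
Qed.

End Identity.

Theorem mainTheorem1 (F : numFieldType) :
  FPS (A_coef F) =
    (fps_sqrt (1 - 1728 * fpsX))^-1 *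
    fps_comp (FPS (fun n => (a_coef n)%:R)) (- (fpsX / (1 - 1728 * fpsX))).
Proof. exact: A_coef_identity. Qed.
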